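(* Every Sturmian word $u$ (over the alphabet $\{0,1\}$) has the WELLDOC property.
   Context: An infinite word $u=u_0u_1u_2\cdots$ is an infinite sequence of letters from a finite alphabet. It is aperiodic if it is not of the form $vw^\omega$ with $v,w$ finite words ($w$ nonempty; $w^\omega$ is the infinite repetition of $w$). A finite word $w$ is a factor of $u$ if $w=u_i u_{i+1}\cdots u_{i+|w|-1}$ for some $i$; each such index $i$ is an occurrence of $w$ in $u$. The factor complexity $\mathcal C_u(n)$ is the number of distinct factors of $u$ of length $n$. An aperiodic infinite word $u$ is Sturmian if $\mathcal C_u(n)=n+1$ for all $n\in\mathbb N$ (so $u$ is binary). $\mathrm{Pref}_n u=u_0\cdots u_{n-1}$ is the prefix of length $n$ of $u$, and $|v|_a$ is the number of occurrences of the letter $a$ in the finite word $v$. WELLDOC property: an aperiodic infinite word $u$ over $\{0,1,\dots,d-1\}$ has the WELLDOC property if for every positive integer $m$ and every factor $w$ of $u$, denoting by $i_0,i_1,\dots$ the occurrences of $w$ in $u$, one has $$\{(|\mathrm{Pref}_{i_j}u|_0,\dots,|\mathrm{Pref}_{i_j}u|_{d-1})\bmod m : j\in\mathbb N\}=\mathbb Z_m^d.$$ *)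

(* Defs.v *)
From mathcomp Require Import all_boot.
From mathcomp Require Import boolp classical_sets.

Set Implicit Arguments.
Unset Strict Implicit.
Unset Printing Implicit Defensive.

Local Open Scope classical_set_scope.

Section Words.

Variable A : finType.
Implicit Types (u : nat -> A) (v w : seq A).

Definition eventually_periodic u : Prop :=
  exists v w, w <> [::] /\
    forall i, u i = if i < size v then nth (u 0) v i
                    else nth (u 0) w ((i - size v) %% size w).

Definition aperiodic u : Prop := ~ eventually_periodic u.

Definition occurrence u w (i : nat) : Prop :=
  w = mkseq (fun k => u (i + k)) (size w).

Definition factor u w : Prop := exists i, occurrence u w i.

Definition complexity u (n : nat) : nat :=
  #|[pred t : n.-tuple A | `[< factor u t >]]|.

Definition sturmian u : Prop :=
  aperiodic u /\ forall n, complexity u n = n.+1.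

Definition pref u (n : nat) : seq A := mkseq u n.

End Words.

(* Z_m is represented by its set of residues 'I_m: the type 'Z_m is not
   suitable here because 'Z_1 has two elements. *)
Definition parikh_mod (m : nat) (m_gt0 : 0 < m) (d : nat) (v : seq 'I_d) :
    {ffun 'I_d -> 'I_m} :=
  [ffun a => Ordinal (ltn_pmod (count_mem a v) m_gt0)].

Definition welldoc (d : nat) (u : nat -> 'I_d) : Prop :=
  aperiodic u /\
  forall (m : nat) (m_gt0 : 0 < m) (w : seq 'I_d), factor u w ->
    [set parikh_mod m_gt0 (pref u i) | i in occurrence u w]
      = [set: {ffun 'I_d -> 'I_m}].

(* Main.v *)
From HB Require Import structures.
Require Import Defs.
From mathcomp Require Import all_boot all_algebra.
From mathcomp Require Import boolp.

Set Implicit Arguments.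
Unset Strict Implicit.
Unset Printing Implicit Defensive.

Import GRing.Theory.

(** Let [P i] be the Parikh vector modulo [m] of the prefix of length [i], and
    for a factor [x] let [values x] be the set of all [P i] such that [x] occurs
    at [i].  The claim is that [values x] is the whole group [G].  All that
    matters about Parikh vectors is that they define a surjective morphism
    [phi] from words to a finite abelian group [G].

    Because the complexity is [n + 1], there is exactly one right special
    factor [r_n] of each length [n] (aperiodicity gives existence, counting
    gives uniqueness), and every factor [x] occurs infinitely often.  Moreover
    [x] is a prefix of some right special factor: otherwise all occurrences of
    [x] would be followed by the same infinite word, which would make the word
    eventually periodic.

    Among the factors that contain [x], take one with the fewest values; it
    extends to a right special factor [y] of length [n], which has as few
    values.  If [y] occurs at [i < j], the factor covering both occurrences has
    as many values as [y]; since it begins and ends with [y], translation by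
    [P j - P i] maps [values y] into itself.  So the subgroup [H] of the
    translations that preserve [values y] contains all these differences.

    It remains to see that [H = G].  Say that windows of length [k] determine
    [P] modulo [H] when [P i - P j] is in [H] as soon as the factors of length
    [k] at [i] and [j] agree.
    - This holds for [k = n] ([window_determines_right_special]): the words read
      from [i] and from [j] agree until they split, which they do just after
      reading [y], at positions where [P] differs by an element of [H].
    - If it holds for [k + 1], it holds for [k] ([window_determines_pred]): the
      next letter matters only for [r_k]; since [r_(k+1) = a r_k] for some
      letter [a], both letters follow [a r_k], so the two classes attached to
      [r_k] are both the class attached to [a r_k] plus [phi a].
    For [k = 0] all the [P i] are congruent modulo [H], hence [H] contains the
    image of each letter, and [H = G] ([window_determines_full]).  A nonempty
    set that all translations preserve is [G]; thus [values y], and a fortiori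
    [values x], is [G] ([values_full]). *)

(** * Windows of an infinite word *)

Section Windows.

Variable A : finType.
Implicit Types (u : nat -> A) (w x y : seq A).

(** The factor [u i ... u (i + n - 1)] of length [n] that occurs at [i]. *)
Definition window u i n : seq A := mkseq (fun k => u (i + k)) n.

Lemma size_window u i n : size (window u i n) = n.
Proof. exact: size_mkseq. Qed.

Lemma windowS u i n : window u i n.+1 = rcons (window u i n) (u (i + n)).
Proof. exact: mkseqS. Qed.

Lemma window_cat u i a b :
  window u i (a + b) = window u i a ++ window u (i + a) b.
Proof.
elim: b => [|b IHb]; first by rewrite addn0 cats0.
by rewrite addnS !windowS IHb rcons_cat addnA.
Qed.

Lemma eq_windowP u i j n :
  window u i n = window u j n <-> forall k, k < n -> u (i + k) = u (j + k).
Proof.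
split=> [E k lt_kn|E].
  have /(congr1 (fun s => nth (u 0) s k)) := E.
  by rewrite !nth_mkseq.
by apply: (@eq_from_nth _ (u 0)); rewrite !size_window // => k lt_kn;
  rewrite !nth_mkseq // E.
Qed.

Lemma occurrence_window u i n : occurrence u (window u i n) i.
Proof. by rewrite /occurrence size_window. Qed.

Lemma occurrence_catl u x y i : occurrence u (x ++ y) i -> occurrence u x i.
Proof.
rewrite /occurrence -/(window _ _ _) size_cat window_cat => /eqP.
by rewrite eqseq_cat ?size_window // => /andP[/eqP Ex _].
Qed.

Lemma occurrence_catr u x y i :
  occurrence u (x ++ y) i -> occurrence u y (i + size x).
Proof.
rewrite /occurrence -/(window _ _ _) size_cat window_cat => /eqP.
by rewrite eqseq_cat ?size_window // => /andP[_ /eqP].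
Qed.

Lemma window_occurrence u x i n :
  occurrence u x i -> size x = n -> window u i n = x.
Proof. by move=> + <-; rewrite /occurrence -/(window _ _ _) => <-. Qed.

(** * Aperiodic words *)

Lemma eventually_periodicP u :
  eventually_periodic u <->
  exists i j, i < j /\ forall k, u (i + k) = u (j + k).
Proof.
split=> [[v [w [wN0 uE]]]|[i [j [lt_ij uE]]]].
  have w_gt0 : 0 < size w by case: w wN0 {uE}.
  exists (size v), (size v + size w); split; first by rewrite -addn1 leq_add2l.
  move=> k; rewrite (uE (size v + k)) (uE (size v + size w + k)) -addnA.
  by rewrite !ltnNge !leq_addr /= !addKn -[in RHS]modnDml modnn.
exists (window u 0 i), (window u i (j - i)); split.
  by move/(congr1 size)/eqP; rewrite size_window subn_eq0 leqNgt lt_ij.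
move=> k; rewrite !size_window.
have p_gt0 : 0 < j - i by rewrite subn_gt0.
case: ltnP => [lt_ki|le_ik]; first by rewrite nth_mkseq.
rewrite nth_mkseq ?ltn_pmod // -{1}(subnKC le_ik).
rewrite {1}(divn_eq (k - i) (j - i)).
elim: (_ %/ _) => // q <-.
by rewrite mulSn -addnA addnA subnKC ?(ltnW lt_ij) // uE.
Qed.

Lemma aperiodic_tail u N : aperiodic u -> aperiodic (fun k => u (N + k)).
Proof.
move=> aper /eventually_periodicP[i [j [lt_ij uE]]].
apply: aper; apply/eventually_periodicP; exists (N + i), (N + j).
by rewrite ltn_add2l; split=> // k; rewrite -!addnA.
Qed.

(** A factor [x] is right special when it occurs at two positions followed by
    different letters. *)
Definition right_special u x : Prop :=
  exists i j, [/\ occurrence u x i, occurrence u x j &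
                  u (i + size x) != u (j + size x)].

Lemma right_special_window u i j n :
  window u i n = window u j n -> u (i + n) != u (j + n) ->
  right_special u (window u i n).
Proof.
move=> E ne; exists i, j; rewrite size_window; split=> //.
  exact: occurrence_window.
by rewrite E; apply: occurrence_window.
Qed.

Lemma right_special_catr u x y : right_special u (x ++ y) -> right_special u y.
Proof.
move=> [i [j [/occurrence_catr xi /occurrence_catr xj]]].
by rewrite size_cat !addnA => ne; exists (i + size x), (j + size x).
Qed.

(** In an aperiodic word, the common factor read from two different positions
    cannot be prolonged forever. *)
Lemma aperiodic_branch u i j n :
    aperiodic u -> i < j -> window u i n = window u j n ->
  exists d, window u i (n + d) = window u j (n + d) /\
            u (i + (n + d)) != u (j + (n + d)).
Proof.
move=> aper lt_ij Eij.
have exk : exists k, u (i + k) != u (j + k).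
  apply: contrapT => nex; apply: aper; apply/eventually_periodicP.
  exists i, j; split=> // k; apply/eqP; apply: contrapT => ne.
  by apply: nex; exists k; apply/negP.
have [k ne_k min_k] := ex_minnP exk.
have le_nk : n <= k.
  rewrite leqNgt; apply/negP => lt_kn.
  by move/eq_windowP/(_ k lt_kn)/eqP: Eij; apply/negP.
exists (k - n); rewrite subnKC //; split=> //.
apply/eq_windowP => l lt_lk; apply/eqP/negP => /negP/min_k.
by rewrite leqNgt lt_lk.
Qed.

Lemma aperiodic_right_special u n :
  aperiodic u -> exists2 x, size x = n & right_special u x.
Proof.
move=> aper.
(* Pigeonhole: two of the first [#|A| ^ n + 1] windows of length [n] agree. *)
pose f (i : 'I_(#|{: n.-tuple A}|.+1)) : n.-tuple A :=
  [tuple u (i + k) | k < n].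
have fE i : f i = window u i n :> seq A.
  rewrite /f /window /mkseq /= -val_enum_ord -map_comp.
  by apply: eq_map.
have /injectivePn[i [j ne_ij Ef]] : ~~ injectiveb f.
  by apply/negP => /injectiveP/leq_card; rewrite card_ord ltnn.
have Eij : window u i n = window u j n by rewrite -!fE Ef.
wlog lt_ij : i j ne_ij Ef Eij / i < j.
  move=> W; case: (ltngtP i j) => [lt|lt|E]; first exact: (W i j).
    by apply: (W j i) => //; rewrite eq_sym.
  by rewrite (val_inj E) eqxx in ne_ij.
have [d [Ed ne_d]] := aperiodic_branch aper lt_ij Eij.
exists (window u (i + d) n); first by rewrite size_window.
apply: (@right_special_catr _ (window u i d)).
by rewrite -window_cat addnC; apply: right_special_window Ed ne_d.
Qed.

(** * Right special factors and complexity *)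

(** Each factor of length [n] has an extension of length [n.+1], and a right
    special one has at least two. *)
Lemma complexity_right_special u n (X : {set n.-tuple A}) :
  (forall x : n.-tuple A, x \in X -> right_special u x) ->
  complexity u n + #|X| <= complexity u n.+1.
Proof.
move=> XP.
(* [b.1] is a letter that may follow [x], and [b.2] another one if [x] is in
   [X]. *)
pose good (x : n.-tuple A) (b : A * A) :=
  (factor u x -> factor u (rcons x b.1)) /\
  (x \in X -> factor u (rcons x b.2) /\ b.1 != b.2).
have /choice[e eP] (x : n.-tuple A) : exists b, good x b.
  have [/XP[i [j [xi xj ne]]]|xNX] := boolP (x \in X).
    exists (u (i + size x), u (j + size x)); split=> [_|_] /=.
      by exists i; rewrite {1}xi -windowS; apply: occurrence_window.
    split=> //.
    by exists j; rewrite {1}xj -windowS; apply: occurrence_window.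
  have [[i xi]|xNf] := pselect (factor u x); last first.
    by exists (u 0, u 0); split=> // xX; rewrite xX in xNX.
  exists (u (i + size x), u 0); split=> [_|xX] /=; last by rewrite xX in xNX.
  by exists i; rewrite {1}xi -windowS; apply: occurrence_window.
pose e1 (x : n.-tuple A) : n.+1.-tuple A := [tuple of rcons x (e x).1].
pose e2 (x : n.-tuple A) : n.+1.-tuple A := [tuple of rcons x (e x).2].
have e1_inj : injective e1.
  by move=> x y /(congr1 val)/rcons_inj[/val_inj].
have e2_inj : injective e2.
  by move=> x y /(congr1 val)/rcons_inj[/val_inj].
pose F := [set x : n.-tuple A | `[< factor u x >]].
have <- : #|F| = complexity u n by rewrite cardsE.
rewrite -(card_imset _ e1_inj) -(card_imset X e2_inj).
have dis : [disjoint e1 @: F & e2 @: X].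
  apply/pred0P => z /=; apply/negP => /andP[/imsetP[x _ ->] /imsetP[y yX]].
  move=> /(congr1 val)/rcons_inj[/val_inj Exy]; rewrite Exy => E.
  by have [_] := (eP y).2 yX; rewrite E eqxx.
have /leqifP := leq_card_setU (e1 @: F) (e2 @: X).
rewrite dis => /eqP <-.
apply: subset_leq_card; apply/subsetP => z.
rewrite !inE => /orP[] /imsetP[x xP ->]; apply/asboolP.
  by apply: (eP x).1; move: xP; rewrite inE => /asboolP.
by have [] := (eP x).2 xP.
Qed.

Lemma aperiodic_complexity u n : aperiodic u -> n < complexity u n.
Proof.
move=> aper; elim: n => [|n IHn].
  apply/card_gt0P; exists [tuple]; rewrite inE; apply/asboolP.
  by exists 0.
have [x /eqP sz_x rs_x] := aperiodic_right_special n aper.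
have := @complexity_right_special u n [set Tuple sz_x].
rewrite cards1 addn1 => /(_ _)/(leq_trans _); apply=> // y.
by rewrite inE => /eqP ->.
Qed.

(** The complexity [n + 1] leaves room for a single right special factor of
    each length. *)
Lemma sturmian_right_special_uniq u x y :
  sturmian u -> size x = size y -> right_special u x -> right_special u y ->
  x = y.
Proof.
move=> [_ cu] /eqP sz rs_x rs_y; apply/eqP; apply: contrapT => /negP ne_xy.
pose tx : (size y).-tuple A := Tuple sz; pose ty := in_tuple y.
have := @complexity_right_special u _ [set tx; ty].
rewrite cards2 -val_eqE /= ne_xy !cu addn2 ltnn => /(_ _)/negP; apply=> // z.
by rewrite !inE => /orP[] /eqP ->.
Qed.

(** A tail of a Sturmian word is aperiodic, hence has at least [n + 1] factors
    of length [n]; so it has all the factors of the word. *)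
Lemma sturmian_recurrent u x N :
  sturmian u -> factor u x -> exists2 i, N <= i & occurrence u x i.
Proof.
move=> [aper cu] fx.
pose v k := u (N + k).
pose F (t : nat -> A) := [set y : (size x).-tuple A | `[< factor t y >]].
have sFvu : F v \subset F u.
  apply/subsetP => y; rewrite !inE => /asboolP[i yi]; apply/asboolP.
  exists (N + i); rewrite /occurrence {1}yi.
  by apply: eq_mkseq => k; rewrite /v addnA.
have EF : F v = F u.
  apply/eqP; rewrite eqEcard sFvu !cardsE -/(complexity _ _).
  rewrite -/(complexity v _) cu.
  exact: aperiodic_complexity (aperiodic_tail aper).
have : in_tuple x \in F v by rewrite EF inE; apply/asboolP.
rewrite inE => /asboolP[i /= xi]; exists (N + i); first exact: leq_addr.
by rewrite /occurrence {1}xi; apply: eq_mkseq => k; rewrite /v addnA.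
Qed.

(** Branching from two occurrences of [x] yields a right special factor that
    begins with [x]. *)
Lemma sturmian_right_special_extension u x :
  sturmian u -> factor u x -> exists y, right_special u (x ++ y).
Proof.
move=> st [i xi].
have [j lt_ij xj] := sturmian_recurrent i.+1 st (ex_intro _ i xi).
have Eij : window u i (size x) = window u j (size x).
  by rewrite (window_occurrence xi) // (window_occurrence xj).
have [d [Ed ne_d]] := aperiodic_branch st.1 lt_ij Eij.
exists (window u (i + size x) d).
have := right_special_window Ed ne_d.
by rewrite window_cat (window_occurrence xi).
Qed.

End Windows.

Lemma card2_eq (A : finType) (a b c : A) :
  #|A| = 2 -> a != b -> c != a -> c = b.
Proof.
move=> cardA ne_ab ne_ca; apply/eqP; apply: contrapT => /negP ne_cb.
have := max_card [set c; a; b]; rewrite cardA -setUA cardsU1 cards2 !inE ne_ab.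
by rewrite (negPf ne_ca) (negPf ne_cb).
Qed.

Arguments window {A} u (i n)%_nat_scope.
Arguments pref {A} u n%_nat_scope.

(** * Morphisms to a finite abelian group *)

Section Values.

Local Open Scope ring_scope.

Variables (A : finType) (G : finZmodType) (phi : seq A -> G).
Hypothesis phiD : forall s t, phi (s ++ t) = phi s + phi t.
Variable u : nat -> A.
Hypothesis u_sturmian : sturmian u.

Lemma morphism_nil : phi [::] = 0.
Proof. by apply: (addrI (phi [::])); rewrite -phiD addr0. Qed.

Lemma phi_pref_window i n :
  phi (pref u (i + n)) = phi (pref u i) + phi (window u i n).
Proof.
by rewrite -phiD; congr phi; exact: window_cat u 0 i n.
Qed.

(** The window of length [n] at [i] determines the class modulo [H] of the value
    of [phi] on the prefix of length [i].  [H] is a mere subset here; the lemmas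
    assume the closure properties of subgroups that they need. *)
Definition window_determines (H : {set G}) n : Prop :=
  forall i j, window u i n = window u j n ->
  phi (pref u i) - phi (pref u j) \in H.

(** The two letters that follow the right special factor of length [n] are also
    those that follow the right special factor of length [n + 1], of which it is
    a suffix; here the alphabet has to be binary. *)
Lemma window_determines_pred (H : {set G}) n :
  #|A| = 2%N -> (forall g h, g \in H -> h \in H -> g + h \in H) ->
  window_determines H n.+1 -> window_determines H n.
Proof.
move=> cardA HD Hn i j Eij.
have [E|ne_ij] := eqVneq (u (i + n)%N) (u (j + n)%N).
  by apply: Hn; rewrite !windowS Eij E.
have [z sz_z [i' [j' [zi' zj' ne_z]]]] :=
  aperiodic_right_special n.+1 u_sturmian.1.
have rs_x := right_special_window Eij ne_ij.
(* Dropping the first letter of [z] leaves the right special factor of length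
   [n], that is the window at [i] and [j]. *)
have Ei' : window u i' n.+1 = z by apply: window_occurrence zi' sz_z.
have Ej' : window u j' n.+1 = z by apply: window_occurrence zj' sz_z.
have sucE k : window u k n.+1 = window u k 1 ++ window u (k + 1) n.
  by rewrite -window_cat.
have rs_z : right_special u (window u (i' + 1) n).
  apply: (@right_special_catr _ _ (window u i' 1)).
  by rewrite -sucE Ei'; exists i', j'; split.
have Exi : window u (i' + 1) n = window u i n.
  apply: sturmian_right_special_uniq u_sturmian _ rs_z rs_x.
  by rewrite !size_window.
have /eqP := etrans Ei' (esym Ej').
rewrite !sucE eqseq_cat ?size_window // => /andP[/eqP Ea /eqP Exij].
have Exj : window u (j' + 1) n = window u j n by rewrite -Exij Exi.
have dij a b : window u a n.+1 = z -> window u b n.+1 = z ->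
    phi (pref u (a + 1)) - phi (pref u (b + 1)) \in H.
  move=> Ea' Eb'; rewrite !phi_pref_window.
  have /eqP := etrans Ea' (esym Eb').
  rewrite !sucE eqseq_cat ?size_window // => /andP[/eqP -> _].
  by rewrite opprD addrACA subrr addr0; apply: Hn; rewrite Ea'.
(* Positions [a] and [b] with the same windows of length [n.+1] as [i] and [j]
   can replace them. *)
have glue a b : window u a n = window u i n -> window u b n = window u j n ->
    u (i + n)%N = u (a + n)%N -> u (b + n)%N = u (j + n)%N ->
    phi (pref u a) - phi (pref u b) \in H ->
  phi (pref u i) - phi (pref u j) \in H.
  move=> Eai Ebj Eia Ebj' ab.
  have -> : phi (pref u i) - phi (pref u j) =
      (phi (pref u i) - phi (pref u a)) + (phi (pref u a) - phi (pref u b)) +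
      (phi (pref u b) - phi (pref u j)) by rewrite !addrA !subrK.
  have ia : phi (pref u i) - phi (pref u a) \in H.
    by apply: Hn; rewrite !windowS Eai Eia.
  have bj : phi (pref u b) - phi (pref u j) \in H.
    by apply: Hn; rewrite !windowS Ebj Ebj'.
  by apply: (HD) bj; apply: (HD) ab.
move: ne_z; rewrite sz_z -[n.+1]add1n !addnA => ne_z.
have [Ei|ne_i] := eqVneq (u (i' + 1 + n)%N) (u (i + n)%N).
  apply: (glue (i' + 1)%N (j' + 1)%N) => //; last exact: dij.
  by apply: card2_eq cardA ne_ij _; rewrite -Ei eq_sym.
have Ej := card2_eq cardA ne_ij ne_i.
apply: (glue (j' + 1)%N (i' + 1)%N) => //; last exact: dij.
- by rewrite Exj.
- by rewrite Exi.
rewrite eq_sym in ne_ij; apply/esym; apply: card2_eq cardA ne_ij _.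
by rewrite -Ej eq_sym.
Qed.

Lemma window_determines_right_special (H : {set G}) x :
  right_special u x ->
  (forall i j, (i < j)%N -> occurrence u x i -> occurrence u x j ->
     phi (pref u j) - phi (pref u i) \in H) ->
  (forall g, g \in H -> - g \in H) -> 0 \in H ->
  window_determines H (size x).
Proof.
move=> rs_x Hx HN H0 i j.
wlog lt_ij : i j / (i < j)%N.
  move=> W; case: (ltngtP i j) => [lt|lt|-> _]; first exact: (W i j).
    by move=> E; rewrite -opprB; apply: HN; apply: W.
  by rewrite subrr.
move=> Eij; have [d [Ed ne_d]] := aperiodic_branch u_sturmian.1 lt_ij Eij.
(* The last [size x] letters of the maximal common factor read from [i] and
   [j] are right special, so they form [x]. *)
have Exd : window u (i + d) (size x) = x.
  apply: (sturmian_right_special_uniq u_sturmian (size_window _ _ _)) rs_x.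
  apply: (@right_special_catr _ _ (window u i d)).
  by rewrite -window_cat addnC; apply: right_special_window Ed ne_d.
move/eqP: Ed; rewrite addnC !window_cat eqseq_cat ?size_window //.
move=> /andP[/eqP Ed /eqP Exd']; rewrite Exd in Exd'.
rewrite -opprB; apply: HN.
have -> : phi (pref u j) - phi (pref u i) =
          phi (pref u (j + d)) - phi (pref u (i + d)).
  by rewrite !phi_pref_window Ed opprD addrACA subrr addr0.
by apply: Hx; [rewrite ltn_add2r | rewrite /occurrence -/(window _ _ _) Exd
  | rewrite /occurrence -/(window _ _ _) -Exd'].
Qed.

Lemma window_determines_full (H : {set G}) n :
  #|A| = 2%N -> (forall g h, g \in H -> h \in H -> g + h \in H) ->
  0 \in H -> window_determines H n -> forall s, phi s \in H.
Proof.
move=> cardA HD H0; elim: n => [|n IHn] Hn; last first.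
  by apply: IHn; apply: window_determines_pred Hn.
have letter a : phi [:: a] \in H.
  have [x /size0nil -> [i [j [_ _ ne]]]] :=
    aperiodic_right_special 0 u_sturmian.1.
  rewrite /= !addn0 in ne.
  have [k ->] : exists k, a = u k.
    have [->|ne_a] := eqVneq a (u i); first by exists i.
    by exists j; apply: card2_eq cardA ne ne_a.
  have -> : phi [:: u k] = phi (pref u (k + 1)) - phi (pref u k).
    by rewrite phi_pref_window addrC addKr /window /mkseq /= addn0.
  exact: Hn.
by elim=> [|a s IHs]; rewrite ?morphism_nil // -cat1s phiD HD.
Qed.

(** The values of [phi] on the prefixes of [u] that precede an occurrence of
    [x]. *)
Definition values x : {set G} :=
  [set g | `[< exists2 i, occurrence u x i & phi (pref u i) = g >]].

Lemma values_cat s x t g : g \in values (s ++ x ++ t) -> g + phi s \in values x.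
Proof.
rewrite !inE => /asboolP[i si <-]; apply/asboolP.
exists (i + size s)%N; first exact: occurrence_catl (occurrence_catr si).
by rewrite phi_pref_window (window_occurrence (occurrence_catl si)).
Qed.

(** The periods of a subset of a group. *)
Definition stabilizer (S : {set G}) : {set G} :=
  [set d | [forall g, (g + d \in S) == (g \in S)]].

Lemma stabilizerP (S : {set G}) d :
  reflect (forall g, (g + d \in S) = (g \in S)) (d \in stabilizer S).
Proof. by rewrite inE; apply: (iffP forallP) => E g; apply/eqP; apply: E. Qed.

Lemma stabilizer_sub (S : {set G}) d :
  (forall g, g \in S -> g + d \in S) -> d \in stabilizer S.
Proof.
move=> Sd; pose f g := g + d; have f_inj : injective f := addIr d.
have fS : f @: S = S.
  apply/eqP; rewrite eqEcard card_imset // leqnn andbT.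
  by apply/subsetP => _ /imsetP[g gS ->]; apply: Sd.
by apply/stabilizerP => g; rewrite -{1}fS; apply: mem_imset.
Qed.

(** In a Sturmian word, the prefixes that precede the occurrences of a given
    factor take all values under a surjective morphism to a finite abelian
    group. *)
Lemma values_full x :
  #|A| = 2%N -> (forall g, exists s, phi s = g) -> factor u x ->
  values x = [set: G].
Proof.
move=> cardA phi_surj fx.
pose ext k := `[< exists s t, factor u (s ++ x ++ t) /\
                              #|values (s ++ x ++ t)| = k >].
have exk : exists k, ext k.
  exists #|values x|; apply/asboolP; exists [::], [::].
  by rewrite cat0s cats0.
have [k /asboolP[s [t [fst cst]]] min_k] := ex_minnP exk.
have [t' rs_y] := sturmian_right_special_extension u_sturmian fst.
set y := _ ++ t' in rs_y.
have yE : y = s ++ x ++ (t ++ t') by rewrite /y -!catA.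
have fy : factor u y by have [i [_ [yi _ _]]] := rs_y; exists i.
have min_y v v' : factor u (v ++ y ++ v') -> (k <= #|values (v ++ y ++ v')|)%N.
  move=> fv; apply: min_k; apply/asboolP.
  (* [y] contains [x], so the factors that contain [y] are candidates. *)
  exists (v ++ s), ((t ++ t') ++ v'); move: fv; rewrite yE -!catA.
  by split.
have card_y : #|values y| = k.
  apply/eqP; rewrite eqn_leq; apply/andP; split.
    rewrite -cst; apply: subset_leq_card; apply/subsetP => g.
    by move=> /(@values_cat [::] (s ++ x ++ t)); rewrite morphism_nil addr0.
  by have := min_y [::] [::]; rewrite cat0s cats0; apply.
pose H := stabilizer (values y).
have H0 : 0 \in H by apply/stabilizerP => g; rewrite addr0.
have HD g h : g \in H -> h \in H -> g + h \in H.
  move=> /stabilizerP Hg /stabilizerP Hh; apply/stabilizerP => f.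
  by rewrite addrA Hh Hg.
have HN g : g \in H -> - g \in H.
  by move=> /stabilizerP Hg; apply/stabilizerP => f; rewrite -Hg addrNK.
have Hy i j : (i < j)%N -> occurrence u y i -> occurrence u y j ->
    phi (pref u j) - phi (pref u i) \in H.
  move=> /ltnW le_ij yi yj.
  (* The factor from the occurrence [i] to the end of the occurrence [j] begins
     and ends with [y]; by minimality it has as many values as [y]. *)
  set v := window u i (j - i).
  have vy : window u i (j - i + size y) = v ++ y.
    by rewrite window_cat subnKC // (window_occurrence yj).
  have vyE : v ++ y = y ++ window u (i + size y) (j - i).
    by rewrite -{2}(window_occurrence yi erefl) -window_cat addnC.
  have f_vy : factor u (v ++ y).
    by exists i; rewrite -vy; apply: occurrence_window.
  have val_vy : values (v ++ y) = values y.
    apply/eqP; rewrite eqEcard card_y; apply/andP; split.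
      apply/subsetP => g; rewrite vyE => /(@values_cat [::] y).
      by rewrite morphism_nil addr0.
    by have := min_y v [::]; rewrite cats0; apply.
  apply: stabilizer_sub => g; rewrite -{1}val_vy => gv.
  have -> : phi (pref u j) - phi (pref u i) = phi v.
    by rewrite -(subnKC le_ij) phi_pref_window addrC addKr.
  by apply: (@values_cat v y [::]); rewrite cats0.
have H_all s' : phi s' \in H.
  have Hn := window_determines_right_special rs_y Hy HN H0.
  exact: window_determines_full cardA HD H0 Hn s'.
have [i yi] := fy.
have gi : phi (pref u i) \in values y.
  by rewrite inE; apply/asboolP; exists i.
apply/setP => g; rewrite [RHS]in_setT.
have [s' s'E] := phi_surj (g - phi s - phi (pref u i)).
rewrite -(subrK (phi s) g); apply: (@values_cat s x (t ++ t')); rewrite -yE.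
have /stabilizerP/(_ (phi (pref u i))) := H_all s'.
by rewrite s'E gi addrC subrK => ->.
Qed.

End Values.

(** * Residues of Parikh vectors *)

(* Joins the finite and the additive group structures of [{ffun _ -> _}]. *)
HB.saturate finfun_of.

Section Parikh.

Local Open Scope ring_scope.

Variables (d m : nat) (m_gt0 : (0 < m.+1)%N).

Lemma parikh_mod_cat (s t : seq 'I_d) :
  parikh_mod m_gt0 (s ++ t) = parikh_mod m_gt0 s + parikh_mod m_gt0 t.
Proof.
apply/ffunP => a; rewrite !ffunE; apply: val_inj => /=.
by rewrite count_cat modnDm.
Qed.

Lemma parikh_mod_surj (g : {ffun 'I_d -> 'I_m.+1}) :
  exists s, parikh_mod m_gt0 s = g.
Proof.
exists (flatten [seq nseq (g a) a | a <- enum 'I_d]).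
apply/ffunP => a; rewrite ffunE; apply: val_inj => /=.
rewrite count_flatten -map_comp sumnE big_map big_enum /= (bigD1 a) //=.
rewrite count_nseq /= eqxx mul1n big1 ?addn0 ?modn_small // => b ne_ba.
by rewrite count_nseq /= (negPf ne_ba).
Qed.

End Parikh.

Theorem theorem3p3 (u : nat -> 'I_2) : sturmian u -> welldoc u.
Proof.
move=> st; split; first exact: st.1.
case=> // m m_gt0 w fw; apply/classical_sets.seteqP; split=> // g _.
have := values_full (@parikh_mod_cat 2 m m_gt0) st (card_ord 2)
  (@parikh_mod_surj 2 m m_gt0) fw.
move/setP/(_ g); rewrite !inE => /asboolP[i wi gE].
by exists i.
Qed.
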